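(* Let $\mu=\sum_{j=1}^r\lambda_j\mu_j$, where $\lambda_j\in\mathbb{K}\setminus\{0\}$ and $\mu_j$ are non-negative measures on $\Omega$ with finite moments. Assume that $\delta\in\mathbb{N}$ is such that there exist elements $h_j\in L_{\le\delta}$, $1\le j\le r$, such that $h_j\ge0$ on $\Omega$ and, for all $1\le j,k\le r$, $$\operatorname{supp}(h_j\mu_k)=\begin{cases}\operatorname{supp}\mu_k&\text{if }k=j,\\ \emptyset&\text{otherwise.}\end{cases}$$ Then $$\mathrm{I}(\operatorname{supp}\mu)\cap L_{\le d}=\ker H_{d+\delta,d}$$ holds for all $d\in\mathbb{N}$, with $H_{d+\delta,d}:=\bigl(\langle w,v\rangle_\sigma\bigr)_{w\in B_{d+\delta},\,v\in B_d}$, where $\sigma\colon L\to\mathbb{K}$ denotes the moment functional of $\mu$ and $B_d,B_{d+\delta}$ denote bases of $L_{\le d},L_{\le d+\delta}$, respectively.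
   Context: The statement concerns each of the following two settings ($n\in\mathbb{N}$). Affine case: $\Omega=\mathbb{R}^n$, $\mathbb{K}=\mathbb{R}$, $L=\mathbb{R}[x_1,\dots,x_n]$, and the involution $\circ$ on $\mathbb{K}$ and $L$ is the identity. Trigonometric case: $\Omega=\mathbb{T}^n=\{z\in\mathbb{C}^n:|z_1|=\dots=|z_n|=1\}$, $\mathbb{K}=\mathbb{C}$, $L=\mathbb{C}[x_1^{\pm1},\dots,x_n^{\pm1}]$, and the involution on $L$ is $\bigl(\sum_\alpha p_\alpha x^\alpha\bigr)^{\circ}=\sum_\alpha\overline{p_\alpha}\,x^{-\alpha}$. Non-negative measures are Borel measures; $\mu$ is a $\mathbb{K}$-valued signed measure. The support $\operatorname{supp}\mu$ of a (signed or non-negative) measure is the set of $\xi\in\Omega$ such that $\mu|_U\ne0$ for every open neighborhood $U\subseteq\Omega$ of $\xi$. $h\mu$ denotes the measure with density $h$ with respect to $\mu$. For $X\subseteq\Omega$, $\mathrm{I}(X)=\{p\in L:p(\xi)=0\ \forall\xi\in X\}$. The moment functional of $\mu$ is $\sigma(p)=\int_\Omega p\,\mathrm{d}\mu$, and $\langle q,p\rangle_\sigma:=\sigma(q^{\circ}p)$ for $q,p\in L$. $\{L_{\le d}\}_{d\in\mathbb{N}}$ is a fixed filtration of $L$ by finite-dimensional $\mathbb{K}$-subspaces: $L_{\le d}\subseteq L_{\le e}$ for $d\le e$, $L=\bigcup_dL_{\le d}$, $1\in L_{\le0}$, $L_{\le d}L_{\le e}\subseteq L_{\le d+e}$. The kernel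 of $H_{d+\delta,d}$ is regarded as a subspace of $L_{\le d}$ via the basis $B_d$, i.e. $\ker H_{d+\delta,d}=\{p\in L_{\le d}:\langle q,p\rangle_\sigma=0\ \forall q\in L_{\le d+\delta}\}$. *)

(* Defs.v *)
From HB Require Import structures.
From mathcomp Require Import all_boot all_order all_algebra finmap.
From mathcomp Require Import all_classical all_reals all_analysis.
From mathcomp Require Import complex.
(* The notations of multinomials clash with those of mathcomp-analysis. *)
From mathcomp Require Import -(notations) mpoly monalg.

Set Implicit Arguments.
Unset Strict Implicit.
Unset Printing Implicit Defensive.

Import Order.TTheory GRing.Theory Num.Theory.
Import numFieldNormedType.Exports.

Local Open Scope classical_set_scope.
Local Open Scope ring_scope.
Local Open Scope complex_scope.

Section linear_algebra.
Context {K : fieldType} {L : comAlgType K}.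

Definition span_of m (B : 'I_m -> L) : set L :=
  [set \sum_i c i *: B i | c in [set: 'I_m -> K]].

Definition is_basis (V : set L) m (B : 'I_m -> L) : Prop :=
  V = span_of B /\
  forall c : 'I_m -> K, \sum_i c i *: B i = 0 -> forall i, c i = 0.

Record is_filtration (F : nat -> set L) : Prop := IsFiltration {
  filtration_findim : forall d, exists m (B : 'I_m -> L), F d = span_of B;
  filtration_le : forall d e, (d <= e)%N -> F d `<=` F e;
  filtration_exhaustive : \bigcup_d F d = setT;
  filtration1 : F 0%N 1;
  filtrationM : forall d e p q, F d p -> F e q -> F (d + e)%N (p * q)
}.

Definition circ_form (circ : L -> L) (sigma : L -> K) (q p : L) : K :=
  sigma (circ q * p).

Definition gram (form : L -> L -> K) m' m (B' : 'I_m' -> L) (B : 'I_m -> L) :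
    'M[K]_(m', m) :=
  \matrix_(i, j) form (B' i) (B j).

(* The kernel of H as a subspace of L, B being the basis that indexes the
   columns of H. *)
Definition kernel_in m' m (B : 'I_m -> L) (H : 'M[K]_(m', m)) : set L :=
  [set \sum_j c j 0 *: B j | c in [set c : 'cV[K]_m | H *m c = 0]].

Definition vanishing_ideal (T : Type) (ev : L -> T -> K) (X : set T) : set L :=
  [set p | forall x, X x -> ev p x = 0].

End linear_algebra.

Notation borel T := (g_sigma_algebraType (@open T)).

(* V is \bar R for non-negative and real signed measures, and Cplx R for complex
   measures; the condition on U says that the restriction of mu to U is nonzero. *)
Definition supp {T : ptopologicalType} {V : nmodType} (mu : set (borel T) -> V) :
    set T :=
  [set x | forall U : set T, open U -> U x ->
     exists2 A : set (borel T), measurable A & mu (A `&` U) <> 0].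

Section signed_measure.
Context d (T : measurableType d) (R : realType).

(* The integral against a signed measure is the difference of the integrals
   against its Jordan components, which do not depend on the choice of the
   Hahn decomposition. *)
Definition charge_integral (nu : {charge set T -> \bar R}) (f : T -> R) : R :=
  let P := cid (Hahn_decomposition nu) in
  let N := cid (svalP P) in
  Rintegral (jordan_pos (svalP N)) setT f -
  Rintegral (jordan_neg (svalP N)) setT f.

Definition density (mu : {measure set T -> \bar R}) (h : T -> R) (A : set T) :
    \bar R :=
  \int[mu]_(x in A) (h x)%:E.

End signed_measure.

(* R[i] with the numClosedFieldType structure as head, from which its topology is
   inferred. *)
Definition Cplx (R : realType) : numClosedFieldType := R[i].

Section complex_measure.
Context d (T : measurableType d) (R : realType).

Record complex_measure := ComplexMeasure {
  cmeasure_val :> set T -> Cplx R;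
  cmeasure0 : cmeasure_val set0 = 0;
  cmeasure_sigma_additive : forall A : nat -> set T,
    (forall i, measurable (A i)) -> trivIset setT A ->
    (fun n => \sum_(0 <= i < n) cmeasure_val (A i)) @ \oo -->
      cmeasure_val (\bigcup_i A i)
}.

Definition cmeasure_re (mu : complex_measure) (A : set T) : \bar R :=
  (complex.Re (mu A))%:E.
Definition cmeasure_im (mu : complex_measure) (A : set T) : \bar R :=
  (complex.Im (mu A))%:E.

Let cvg_part (g : {additive R[i] -> R}) (u : nat -> Cplx R) (l : Cplx R) :
  (forall z : R[i], `|g z|%:C <= `|z|) ->
  u @ \oo --> l -> (fun n => g (u n)) @ \oo --> g l.
Proof.
move=> gle /cvgrPdist_lt ul; apply/cvgrPdist_lt => e e0.
have e0' : (0 : Cplx R) < e%:C by rewrite ltcR.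
near=> n; rewrite -raddfB -ltcR; apply: le_lt_trans (gle _) _.
by near: n; exact: ul.
Unshelve. all: by end_near. Qed.

Let part_sigma_additive (g : {additive R[i] -> R}) (mu : complex_measure) :
  (forall z : R[i], `|g z|%:C <= `|z|) ->
  semi_sigma_additive (fun A => (g (mu A))%:E).
Proof.
move=> gle A mA tA _.
have := cvg_part gle (@cmeasure_sigma_additive mu A mA tA) => h.
under eq_fun do rewrite sumEFin.
apply/cvg_EFin; first by near=> n.
apply: cvg_trans h; apply: near_eq_cvg; near=> n.
by rewrite /= raddf_sum.
Unshelve. all: by end_near. Qed.

Let normc_ge_Im (z : R[i]) : `|complex.Im z|%:C <= `|z|.
Proof.
by case: z => a b; simpc; rewrite -sqrtr_sqr ler_wsqrtr // lerDr sqr_ge0.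
Qed.

Let cmeasure_re0 mu : cmeasure_re mu set0 = 0%E.
Proof. by rewrite /cmeasure_re cmeasure0. Qed.

Let cmeasure_im0 mu : cmeasure_im mu set0 = 0%E.
Proof. by rewrite /cmeasure_im cmeasure0. Qed.

HB.instance Definition _ mu := isCharge.Build d T R (cmeasure_re mu)
  (cmeasure_re0 mu) (fun _ _ => isT)
  (@part_sigma_additive (@complex.Re R) mu (@normc_ge_Re R)).

HB.instance Definition _ mu := isCharge.Build d T R (cmeasure_im mu)
  (cmeasure_im0 mu) (fun _ _ => isT)
  (@part_sigma_additive (@complex.Im R) mu normc_ge_Im).

Definition cmeasure_integral (mu : complex_measure) (f : T -> Cplx R) : Cplx R :=
  let fr x := complex.Re (f x) in
  let fi x := complex.Im (f x) in
  (charge_integral (cmeasure_re mu) fr - charge_integral (cmeasure_im mu) fi) +i*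
  (charge_integral (cmeasure_re mu) fi + charge_integral (cmeasure_im mu) fr).

Definition cintegrable (mu : {measure set T -> \bar R}) (f : T -> Cplx R) : Prop :=
  mu.-integrable setT (fun x => (complex.Re (f x))%:E) /\
  mu.-integrable setT (fun x => (complex.Im (f x))%:E).

Definition cdensity (mu : {measure set T -> \bar R}) (h : T -> Cplx R)
    (A : set T) : Cplx R :=
  Rintegral mu A (fun x => complex.Re (h x)) +i*
  Rintegral mu A (fun x => complex.Im (h x)).

End complex_measure.

Definition peval n (R : realType) (p : mpoly n R) (x : 'rV[R]_n) : R :=
  meval (fun i => x 0 i) p.

(* Only the module structure comes from malg: its product requires a monoid of
   exponents without non-trivial units, which the group of integer exponents is
   not. *)
Definition laurent (n : nat) (K : fieldType) : Type := malg 'rV[int]_n K.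

HB.instance Definition _ n (K : fieldType) := GRing.Lmodule.on (laurent n K).

Lemma mulA_spanned (I : Type) (V : zmodType) (mul : V -> V -> V) (e : I -> V) :
  left_zero 0 mul -> right_zero 0 mul ->
  left_distributive mul +%R -> right_distributive mul +%R ->
  (forall P : V -> Prop, P 0 -> (forall u v, P u -> P v -> P (u + v)) ->
     (forall i, P (e i)) -> forall v, P v) ->
  (forall i j k, mul (e i) (mul (e j) (e k)) = mul (mul (e i) (e j)) (e k)) ->
  associative mul.
Proof.
move=> mul0 mulx0 mulDl mulDr ind eA p q r; move: p.
apply: (ind) => [|p1 p2 IH1 IH2|i]; first by rewrite !mul0.
  by rewrite !mulDl IH1 IH2.
move: q; apply: (ind) => [|q1 q2 IH1 IH2|j]; first by rewrite mulx0 !mul0 mulx0.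
  by rewrite mulDl !mulDr mulDl IH1 IH2.
move: r; apply: (ind) => [|r1 r2 IH1 IH2|k]; first by rewrite !mulx0.
  by rewrite !mulDr IH1 IH2.
exact: eA.
Qed.

Section laurent_ring.
Context (n : nat) (K : fieldType).
Implicit Types p q : laurent n K.

Local Notation M := 'rV[int]_n.

Definition laurent_mul p q : laurent n K :=
  \sum_(a <- msupp p) \sum_(b <- msupp q)
    mkmalgU (a + b) (mcoeff a p * mcoeff b q).

Definition laurent_one : laurent n K := mkmalgU 0 1.

Let mulEw (d1 d2 : {fset M}) p q :
  (msupp p `<=` d1)%fset -> (msupp q `<=` d2)%fset ->
  laurent_mul p q =
  \sum_(a <- d1) \sum_(b <- d2) mkmalgU (a + b) (mcoeff a p * mcoeff b q).
Proof.
move=> le1 le2; rewrite /laurent_mul (big_fset_incl _ le1) /=.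
  apply/eq_bigr=> a _; apply/big_fset_incl => // b _ /mcoeff_outdom ->.
  by rewrite mulr0 monalgU0.
move=> a _ /mcoeff_outdom pa.
by rewrite big1 // => b _; rewrite pa mul0r monalgU0.
Qed.

Let mulC : commutative laurent_mul.
Proof.
move=> p q; rewrite /laurent_mul exchange_big /=.
by apply: eq_bigr => b _; apply: eq_bigr => a _; rewrite addrC mulrC.
Qed.

Let mul0 : left_zero 0 laurent_mul.
Proof. by move=> p; rewrite /laurent_mul msupp0 big_seq_fset0. Qed.

Let mulDl : left_distributive laurent_mul +%R.
Proof.
move=> p q r.
rewrite (mulEw (fsubsetUl (msupp p) (msupp q)) (fsubset_refl _)).
rewrite (mulEw (fsubsetUr (msupp p) (msupp q)) (fsubset_refl _)).
rewrite (mulEw (msuppD_le p q) (fsubset_refl _)).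
rewrite -big_split /=; apply/eq_bigr=> a _.
rewrite -big_split /=; apply/eq_bigr=> b _.
by rewrite mcoeffD mulrDl monalgUD.
Qed.

Let mulDr : right_distributive laurent_mul +%R.
Proof. by move=> p q r; rewrite mulC mulDl !(mulC p). Qed.

Let mulUU (a b : M) (x y : K) :
  laurent_mul (mkmalgU a x) (mkmalgU b y) = mkmalgU (a + b) (x * y).
Proof. by rewrite (mulEw msuppU_le msuppU_le) !big_seq_fset1 !mcoeffUU. Qed.

Let laurent_ind (P : laurent n K -> Prop) :
  P 0 -> (forall p q, P p -> P q -> P (p + q)) ->
  (forall ax : M * K, P (mkmalgU ax.1 ax.2)) -> forall p, P p.
Proof.
move=> P0 PD PU p; rewrite [p]monalgE; apply: big_ind => // a _.
exact: (PU (a, mcoeff a p)).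
Qed.

Let mulx0 : right_zero 0 laurent_mul.
Proof. by move=> p; rewrite mulC mul0. Qed.

Let mulA : associative laurent_mul.
Proof.
move=> p q r.
apply: (mulA_spanned mul0 mulx0 mulDl mulDr laurent_ind).
move=> [a x] [b y] [c z].
apply: etrans (esym (congr1 (laurent_mul^~ _) (mulUU _ _ _ _))).
apply: etrans (congr1 (laurent_mul _) (mulUU _ _ _ _)) _.
by rewrite [LHS]mulUU [RHS]mulUU addrA mulrA.
Qed.

Let mul1 : left_id laurent_one laurent_mul.
Proof.
move=> p; rewrite (mulEw msuppU_le (fsubset_refl _)) big_seq_fset1.
rewrite [RHS]monalgE; apply: eq_bigr => a _.
by rewrite mcoeffUU add0r mul1r.
Qed.

Let one_neq0 : laurent_one != 0.
Proof. by rewrite monalgU_eq0 oner_eq0. Qed.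

HB.instance Definition _ := GRing.Zmodule_isComNzRing.Build (laurent n K)
  mulA mulC mul1 mulDl one_neq0.

Let scaleU (c x : K) (a : M) :
  c *: (mkmalgU a x : malg M K) = mkmalgU a (c * x).
Proof.
apply/malgP => k; rewrite (mcoeffZ c (mkmalgU a x) k).
by rewrite [RHS]mcoeffU -mulrnAr; congr (c * _); exact: mcoeffU.
Qed.

Let scaleAl (c : K) p q : c *: (p * q) = (c *: p) * q.
Proof.
rewrite [RHS](mulEw (msuppZ_le c p) (fsubset_refl _)) [p * q]/(laurent_mul p q).
rewrite /laurent_mul scaler_sumr; apply: eq_bigr => a _.
rewrite scaler_sumr; apply: eq_bigr => b _.
rewrite (mcoeffZ c p a) -mulrA.
exact: scaleU.
Qed.

HB.instance Definition _ := GRing.Lmodule_isLalgebra.Build K (laurent n K)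
  scaleAl.
HB.instance Definition _ := GRing.Lalgebra_isComAlgebra.Build K (laurent n K).

End laurent_ring.

Definition laurent_circ n (R : realType) (p : laurent n (Cplx R)) :
    laurent n (Cplx R) :=
  \sum_(a <- msupp p) mkmalgU (- a) ((mcoeff a p)^* )%R.

Definition torus_set n (R : realType) : set 'rV[Cplx R]_n :=
  [set z | forall i, `|z 0 i| = 1].

Definition torus n (R : realType) : Type := set_type (@torus_set n R).

HB.instance Definition _ n (R : realType) :=
  Topological.copy (torus n R) (set_type (@torus_set n R)).

Section torus_pointed.
Context (n : nat) (R : realType).

Let torus_set1 : const_mx 1 \in @torus_set n R.
Proof. by apply/mem_set => i; rewrite mxE normr1. Qed.

HB.instance Definition _ := isPointed.Build (torus n R)
  (exist _ (const_mx 1) torus_set1).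

End torus_pointed.

Definition leval n (R : realType) (p : laurent n (Cplx R)) (z : torus n R) :
    Cplx R :=
  \sum_(a <- msupp p) mcoeff a p * \prod_(i < n) (set_val z 0 i) ^ (a 0 i).

(* Main.v *)
Require Import Defs.
From mathcomp Require Import all_boot all_order all_algebra finmap.
From mathcomp Require Import all_classical all_reals all_analysis.
From mathcomp Require Import measurable_realfun complex.
From mathcomp Require Import ring lra.
From mathcomp Require Import -(notations) mpoly monalg.

Set Implicit Arguments.
Unset Strict Implicit.
Unset Printing Implicit Defensive.

Import Order.TTheory GRing.Theory Num.Theory.
Import numFieldNormedType.Exports.

Local Open Scope classical_set_scope.
Local Open Scope ring_scope.

(** Write mu = \sum_j lambda_j mu_j.

    If p vanishes on supp mu, then so does circ q * p for every q.  Both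
    spaces are second countable, so the complement of supp mu is a countable
    union of basic open sets on which mu is zero; hence it is mu-null
    ([charge_setC_supp]) and sigma (circ q * p) = 0.

    Conversely, let p lie in F d and in the kernel.  The multiplier h_j
    isolates the j-th component: q := p * h_j lies in F (d + delta), and
    circ q * p takes the values |p|^2 h_j because h_j is real on the space, so
      0 = sigma (circ q * p) = \sum_k lambda_k \int |p|^2 h_j d mu_k.
    For k != j the measure h_j mu_k has empty support, hence is zero, and the
    k-th term vanishes ([Rintegral_density_supp0]).  What remains is
    \int |p|^2 h_j d mu_j = 0 with a nonnegative integrand, which forces the
    continuous function p to vanish on supp (h_j mu_j) = supp mu_j
    ([vanish_on_supp_density]).  As j is arbitrary and supp mu is contained in
    the union of the supports of the mu_j ([supp_sub_bigcup]), p vanishes on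
    supp mu.

    All this uses sigma p = \sum_j lambda_j \int p d mu_j, although
    the integral against mu is defined through the Jordan decomposition of mu,
    which is not the splitting of the sum by the signs of the coefficients.
    The two are linked by an identity between finite positive measures
    ([charge_integral_combination]); a complex measure is treated through its
    real and imaginary parts ([cmeasure_integral_combination]).  Since sigma is
    then linear, the kernel of the Gram matrix is the space of those p in F d
    that are annihilated by the whole of F (d + delta) ([kernel_in_gram]). *)

(** * Second countability of the two spaces *)

(** The radii [r] are a parameter because a general field of scalars need not be
    archimedean, and then a sequence of radii tending to 0 may not exist. *)
Lemma separable_second_countable (K : numFieldType) (T : pseudoMetricType K)
    (D : set T) (r : nat -> K) :
  countable D -> dense D ->
  (forall k, 0 < r k) -> (forall e, 0 < e -> exists k, r k < e) ->
  @second_countable T.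
Proof.
move=> cD denseD r0 rsmall.
exists [set (ball yk.1 (r yk.2))° | yk in D `*` [set: nat]].
  exact/(sub_countable (card_image_le _ _))/countableX.
split=> [_ [yk _ <-]|x V /nbhs_ballP[e /= e0 eV]]; first exact: open_interior.
have [k rk] : exists k, r k < e / 2 by apply/rsmall/divr_gt0.
have [y [/interior_subset/ball_sym yx Dy]] :
    (ball x (r k / 2))° `&` D !=set0.
  apply: denseD (@open_interior _ _).
  by exists x; apply/nbhsx_ballx/divr_gt0.
exists (ball y (r k))°; first split; first by exists (y, k).
- apply/nbhs_ballP; exists (r k / 2); first exact: divr_gt0.
  by move=> z xz; rewrite [r k]splitr; exact: ball_triangle yx xz.
- apply: subset_trans (@interior_subset _ _) _ => z yz; apply: eV.
  rewrite [e]splitr; apply: (@ball_triangle _ _ y).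
    apply/ball_sym/le_ball/yx/le_trans/ltW/rk.
    by rewrite ler_pdivrMr // ler_peMr ?ler1n // ltW.
  exact: le_ball (ltW rk) _ yz.
Qed.

(** A basis consists of the boxes with basic sides; as there are finitely many
    entries, they are indexed by finite functions into a countable set. *)
Lemma second_countable_mx (T : topologicalType) m n :
  @second_countable T -> @second_countable 'M[T]_(m, n).
Proof.
move=> [B /countable_injP[f finj] [Bopen Bbase]].
pose box (P : {ffun 'I_m * 'I_n -> set T}) : set 'M[T]_(m, n) :=
  [set M | forall i j, P (i, j) (M i j)].
pose S := [set P : {ffun 'I_m * 'I_n -> set T} | forall ij, B (P ij)].
exists (box @` S).
  apply: sub_countable (card_image_le _ _) _; apply/countable_injP.
  exists (fun P => choice.pickle [ffun ij => f (P ij)]) => P Q.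
  rewrite !inE => SP SQ.
  move=> /(pcan_inj (@choice.pickleK _))/ffunP fPQ; apply/ffunP => ij.
  apply: finj; [exact/mem_set/SP|exact/mem_set/SQ|].
  by move: (fPQ ij); rewrite !ffunE.
split=> [_ [P SP <-]|M V [P /= MP PV]].
  rewrite openE => M PM; exists (fun i j => P (i, j)) => // i j.
  by apply: open_nbhs_nbhs; split; [exact/Bopen/SP|exact: PM].
have /choice[Q QP] ij :
    exists Q, [/\ B Q, Q (M ij.1 ij.2) & Q `<=` P ij.1 ij.2].
  by have [Q [BQ QM] QP] := Bbase _ _ (MP ij.1 ij.2); exists Q.
exists (box (finfun Q)).
  split; first by exists (finfun Q) => // ij; rewrite ffunE; have [] := QP ij.
  by move=> i j; rewrite ffunE; have [] := QP (i, j).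
move=> N QN; apply: PV => i j; have [_ _] := QP (i, j); apply.
by have := QN i j; rewrite ffunE.
Qed.

Lemma second_countable_set_type (T : topologicalType) (A : set T) :
  @second_countable T -> @second_countable (set_type A).
Proof.
move=> [B cB [Bopen Bbase]]; exists [set set_val @^-1` V | V in B].
  exact: sub_countable (card_image_le _ _) _.
split=> [_ [V /Bopen oV <-]|x U].
  by apply: open_comp => // y _; exact: initial_continuous.
rewrite nbhsE => -[W [[V oV <-] /= Vx] VU].
have [Q [BQ Qx] QV] := Bbase (set_val x) V (open_nbhs_nbhs (conj oV Vx)).
exists (set_val @^-1` Q); first by split => //; exists Q.
by apply: subset_trans VU => y /QV.
Qed.

Lemma second_countable_real (R : realType) : @second_countable R.
Proof.
apply: (@separable_second_countable R R (range ratr)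
         (fun k => k.+1%:R^-1)) => //.
- exact: sub_countable (card_image_le _ _) _.
- exact: dense_rat.
- by move=> e /(@ltr_add_invr _ 0)[k]; rewrite add0r; exists k.
Qed.

Lemma second_countable_complex (R : realType) : @second_countable (Cplx R).
Proof.
(* The Gaussian rationals are dense. *)
pose q (ab : rat * rat) : Cplx R := (ratr ab.1 +i* ratr ab.2)%C.
apply: (@separable_second_countable _ (Cplx R : numFieldType) (range q)
         (fun k => k.+1%:R^-1)) => //.
- exact: sub_countable (card_image_le _ _) _.
- move=> U [[a b] Uab]; rewrite openE => /(_ _ Uab)/nbhs_ballP[[e ?] /=].
  (* A positive radius in the complex numbers is real. *)
  rewrite ltcE /= => /andP[/eqP -> e0] eU.
  have e20 : 0 < e / 2 by exact: divr_gt0.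
  have near_rat (x : R) : exists p, `|x - ratr p| < e / 2.
    have [y [xy [p _ py]]] : ball x (e / 2) `&` range ratr !=set0.
      by apply: dense_rat (ball_open _ _); exists x; exact: ballxx.
    by exists p; rewrite py.
  have [[p ap] [p' bp]] := (near_rat a, near_rat b).
  exists (q (p, p')); split; last by exists (p, p').
  apply: eU; rewrite /ball /= normc_def ltcR /=.
  apply: (@le_lt_trans _ _ (`|a - ratr p| + `|b - ratr p'|)).
    rewrite -[leRHS]ger0_norm ?addr_ge0// -[leRHS]sqrtr_sqr ler_wsqrtr//.
    rewrite [leRHS]sqrrD !real_normK ?num_real// [leRHS]addrAC.
    by rewrite lerDl mulrn_wge0// mulr_ge0.
  by rewrite [ltRHS]splitr ltrD.
- move=> [e i]; rewrite ltcE /= => /andP[/eqP -> e0].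
  have [k] := ltr_add_invr e0; rewrite add0r => ke; exists k.
  rewrite (_ : _^-1 = (k.+1%:R^-1)%:C)%C ?ltcR//.
  by rewrite rmorphV ?unitfE// rmorph_nat.
Qed.

(** * The complement of the support is a null set *)

Section jordan.
Context d (T : measurableType d) (R : realType).
Variables (nu : {charge set T -> \bar R}) (P N : set T).
Hypothesis nuPN : hahn_decomposition nu P N.

Lemma jordan_pos_setI A : measurable A -> jordan_pos nuPN A = nu (A `&` P).
Proof. by move=> mA; rewrite jordan_posE cjordan_posE /crestr0 mem_set. Qed.

Lemma jordan_neg_setI A :
  measurable A -> jordan_neg nuPN A = (- nu (A `&` N))%E.
Proof. by move=> mA; rewrite jordan_negE cjordan_negE /crestr0 mem_set. Qed.

End jordan.

Section support.
Context (R : realType) (T : ptopologicalType).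

Lemma open_borel (U : set (borel T)) : open U -> measurable U.
Proof. exact: sub_sigma_algebra. Qed.

Lemma open_setC_supp (V : nmodType) (nu : set (borel T) -> V) :
  open (~` supp nu).
Proof.
rewrite openE => x /= /existsNP[U] /not_implyP[oU] /not_implyP[Ux U0].
rewrite /interior nbhsE; exists U; first by split.
by move=> y Uy; apply: contra_not U0 => /(_ U oU Uy).
Qed.

Hypothesis T2 : @second_countable T.

(** The complement of the support is covered by the basic open sets on which
    [nu] is zero.  There are countably many of them, so [A] can be cut into
    countably many disjoint pieces, each contained in one of them. *)
Lemma charge_setC_supp (nu : {charge set (borel T) -> \bar R})
    (A : set (borel T)) :
  measurable A -> A `<=` ~` supp nu -> nu A = 0%E.
Proof.
move=> mA Asupp.
have [B /pfcard_geP[B0|/unsquash g] [Bopen Bbase]] := T2.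
  have -> : A = set0; last exact: charge0.
  rewrite -subset0 => x _; have [Q []] := Bbase x setT filterT.
  by rewrite B0.
pose null (U : set (borel T)) := forall C, measurable C -> nu (C `&` U) = 0%E.
(* Replacing the other basic sets by the empty set keeps the indices in nat. *)
pose G (k : nat) : set (borel T) := if `[< null (g k) >] then g k else set0.
have gB k : B (g k) by exact: funS.
have nullG k : null (G k).
  by rewrite /G; case: asboolP => // _ C _; rewrite setI0 charge0.
have mG k : measurable (G k).
  rewrite /G; case: asboolP => // _; apply: open_borel; exact: Bopen (gB k).
have AG : A = \bigcup_k (A `&` G k).
  rewrite -setI_bigcupr; apply/esym/setIidPl => x /Asupp /existsNP[U].
  move=> /not_implyP[oU] /not_implyP[Ux U0].
  have [Q [BQ Qx] QU] := Bbase x U (open_nbhs_nbhs (conj oU Ux)).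
  have [k _ gkQ] : exists2 k, True & g k = Q by exact: surj.
  exists k => //; rewrite /G; case: asboolP; first by rewrite gkQ.
  case=> C mC; apply: contra_notP U0 => CQ.
  exists (C `&` g k).
    by apply: measurableI => //; apply: open_borel; exact: Bopen (gB k).
  by rewrite -setIA (setIidl (_ : g k `<=` U)) // gkQ.
have mAG k : measurable (seqDU (fun k => A `&` G k) k).
  by apply: seqDU_measurable => // i; exact: measurableI.
rewrite AG seqDU_bigcup_eq.
have /cvg_lim <- // := @charge_semi_sigma_additive _ _ _ nu _ mAG
  (trivIset_seqDU _) (bigcup_measurable (fun k _ => mAG k)).
rewrite (_ : (fun _ => _) = cst 0%E) ?lim_cst //; apply/funext => n.
rewrite big1 // => k _.
rewrite (_ : seqDU _ k = seqDU (fun k => A `&` G k) k `&` G k).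
  exact: nullG.
apply/esym/setIidl; apply: (subset_trans (@subset_seqDU _ _ _)).
exact: subIsetr.
Qed.

(** Both Jordan components restrict [nu] to a set of the Hahn decomposition, so
    they inherit its null sets. *)
Lemma charge_integral_vanish (nu : {charge set (borel T) -> \bar R})
    (f : borel T -> R) :
  measurable_fun setT f -> (forall x, supp nu x -> f x = 0) ->
  charge_integral nu f = 0.
Proof.
move=> mf f0; rewrite /charge_integral.
set P := cid _; set N := cid _.
have mU : measurable (~` supp nu : set (borel T)).
  by apply: open_borel; exact: open_setC_supp.
suff zero (m : {measure set (borel T) -> \bar R}) :
    m (~` supp nu) = 0%E -> Rintegral m setT f = 0.
  have [[mP _] [mN _] _ _] := svalP N.
  rewrite !zero ?subr0 //.
    apply: etrans (jordan_neg_setI (svalP N) mU) _.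
    by rewrite charge_setC_supp ?oppe0 //; exact: measurableI.
  apply: etrans (jordan_pos_setI (svalP N) mU) _.
  by rewrite charge_setC_supp //; exact: measurableI.
move=> m0; rewrite /Rintegral (@ae_eq_integral _ _ _ m setT (cst 0%E)) //.
- by rewrite integral0.
- exact/measurable_EFinP.
- exists (~` supp nu); split => // x /= /not_implyP[_ fx].
  by apply: contra_not fx => /f0 ->.
Qed.
End support.

(** * Integrals against linear combinations of measures *)

Section linear_combination.
Context d (T : measurableType d) (R : realType).

Lemma integrable_le_measure (m1 m2 : {measure set T -> \bar R})
    (f : T -> \bar R) :
  (forall A, measurable A -> (m1 A <= m2 A)%E) ->
  m2.-integrable setT f -> m1.-integrable setT f.
Proof.
move=> m12 /integrableP[mf foo]; apply/integrableP; split=> //.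
apply: le_lt_trans foo; apply: ge0_le_measure_integral => //.
exact: measurableT_comp.
Qed.

Lemma finite_measure_fin_num (mu : {measure set T -> \bar R}) A :
  (mu setT < +oo)%E -> measurable A -> mu A \is a fin_num.
Proof.
move=> mu_fin mA; rewrite ge0_fin_numE // (le_lt_trans _ mu_fin) //.
by rewrite le_measure ?inE.
Qed.

(** Combinations with nonnegative coefficients are measures again, and integrals
    against them are the combinations of the integrals.  This is the part of
    [charge_integral_combination] that does not involve signs. *)
Lemma nonneg_combination r (c : 'I_r -> R)
    (mu_ : 'I_r -> {measure set T -> \bar R}) :
  (forall j, 0 <= c j) ->
  exists2 m : {measure set T -> \bar R},
    (forall A, m A = \sum_j (c j)%:E * mu_ j A)%E &
    forall f : T -> R, measurable_fun setT f ->
      (forall j, (mu_ j).-integrable setT (EFin \o f)) ->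
      m.-integrable setT (EFin \o f) /\
      Rintegral m setT f = \sum_j c j * Rintegral (mu_ j) setT f.
Proof.
move=> c0.
pose c' j : {nonneg R} := NngNum (c0 j).
(* [msum] adds up a sequence indexed by nat, hence the padding with zero. *)
pose m_ (k : nat) : {measure set T -> \bar R} :=
  if insub k is Some j then mscale (c' j) (mu_ j) else mzero.
have m_E (j : 'I_r) : m_ j = mscale (c' j) (mu_ j).
  by rewrite /m_ valK.
have mE A : (msum m_ r A = \sum_j (c j)%:E * mu_ j A)%E.
  by rewrite /msum; apply: eq_bigr => j _; rewrite m_E.
exists (msum m_ r) => // f mf intf.
have mEf : measurable_fun setT (EFin \o f) by exact/measurable_EFinP.
have ge0E (g : T -> \bar R) : (forall x, 0 <= g x)%E -> measurable_fun setT g ->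
    (\int[msum m_ r]_x g x = \sum_j (c j)%:E * \int[mu_ j]_x g x)%E.
  move=> g0 mg; rewrite ge0_integral_measure_sum //; apply: eq_bigr => j _.
  by rewrite m_E ge0_integral_mscale.
have intm : (msum m_ r).-integrable setT (EFin \o f).
  apply/integrableP; split=> //; rewrite ge0E //; last exact: measurableT_comp.
  apply/lte_sum_pinfty => j _; apply: lte_mul_pinfty => //; rewrite ?lee_fin //.
  by have /integrableP[] := intf j.
split=> //; rewrite /Rintegral.
transitivity (fine (\sum_j (c j)%:E * \int[mu_ j]_x (f x)%:E)%E).
  congr fine; rewrite integralE ge0E //; last exact: measurable_funepos.
  rewrite ge0E //; last exact: measurable_funeneg.
  rewrite -fin_num_sumeN => [|j _]; last first.
    by rewrite fin_numM // integrable_neg_fin_num.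
  rewrite -big_split; apply: eq_bigr => j _ /=.
  rewrite (integralE _ _ (fun x => (f x)%:E)) [RHS]muleBr //.
  by rewrite fin_num_adde_defr // integrable_pos_fin_num.
rewrite -sum_fine => [|j _]; last first.
  by rewrite fin_numM // integrable_fin_num.
by apply: eq_bigr => j _; rewrite fineM // integrable_fin_num //; exact: intf.
Qed.

(** Let [pos] and [neg] be the Jordan components of [nu], and [mp] and [mn] the
    combinations of the [mu_ j] with the positive and the negative parts of the
    coefficients as weights.  From nu = pos - neg = mp - mn one gets
    pos + mn = neg + mp, an identity between positive measures that can be
    integrated; [f] is integrable against all four, as pos <= mp and
    neg <= mn. *)
Lemma charge_integral_combination r (lambda : 'I_r -> R)
    (mu_ : 'I_r -> {measure set T -> \bar R}) (nu : {charge set T -> \bar R})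
    (f : T -> R) :
  (forall j, (mu_ j setT < +oo)%E) ->
  (forall A, measurable A -> nu A = \sum_j (lambda j)%:E * mu_ j A)%E ->
  measurable_fun setT f ->
  (forall j, (mu_ j).-integrable setT (EFin \o f)) ->
  charge_integral nu f = \sum_j lambda j * Rintegral (mu_ j) setT f.
Proof.
move=> mu_fin nuE mf intf; rewrite /charge_integral.
set P := cid _; set N := cid _.
pose pos : {measure set T -> \bar R} := jordan_pos (svalP N).
pose neg : {measure set T -> \bar R} := jordan_neg (svalP N).
have max0 (x : R) : 0 <= Num.max x 0 by rewrite le_max lexx orbT.
have max_sub (x : R) : Num.max x 0 - Num.max (- x) 0 = x.
  have [x0|/ltW x0] := leP 0 x; first by rewrite max_r ?oppr_le0 // subr0.
  by rewrite max_l ?oppr_ge0 // sub0r opprK.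
have [mp mpE intp] := nonneg_combination mu_ (fun j => max0 (lambda j)).
have [mn mnE intn] := nonneg_combination mu_ (fun j => max0 (- lambda j)).
have mu_fin_num j A : measurable A -> mu_ j A \is a fin_num.
  exact: finite_measure_fin_num.
have mp_fin A : measurable A -> mp A \is a fin_num.
  move=> mA; rewrite mpE; apply/sum_fin_numP => j _ _.
  by rewrite fin_numM // mu_fin_num.
have mn_fin A : measurable A -> mn A \is a fin_num.
  move=> mA; rewrite mnE; apply/sum_fin_numP => j _ _.
  by rewrite fin_numM // mu_fin_num.
have nu_mp_mn A : measurable A -> (nu A = mp A - mn A)%E.
  move=> mA; rewrite nuE // mpE mnE -fin_num_sumeN => [|j _]; last first.
    by rewrite fin_numM // mu_fin_num.
  rewrite -big_split; apply: eq_bigr => j _ /=.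
  rewrite -(fineK (mu_fin_num j A mA)) -!EFinM -EFinN -EFinD -mulrBl.
  by rewrite max_sub.
have [[mP _] [mN _] _ _] := svalP N.
have pos_le A : measurable A -> (pos A <= mp A)%E.
  move=> mA; have mAP : measurable (A `&` sval P) by exact: measurableI.
  rewrite [pos A](jordan_pos_setI (svalP N)) // nu_mp_mn //.
  apply: (@le_trans _ _ (mp (A `&` sval P))).
    by rewrite geeDl ?oppe_le0.
  by rewrite le_measure ?inE //; exact: measurableI.
have neg_le A : measurable A -> (neg A <= mn A)%E.
  move=> mA; have mAN : measurable (A `&` sval N) by exact: measurableI.
  rewrite [neg A](jordan_neg_setI (svalP N)) // nu_mp_mn //.
  rewrite oppeB ?fin_num_adde_defr ?mp_fin // addeC.
  apply: (@le_trans _ _ (mn (A `&` sval N))).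
    by rewrite geeDl ?oppe_le0.
  by rewrite le_measure ?inE.
have [mp_int mpI] := intp f mf intf; have [mn_int mnI] := intn f mf intf.
have pos_int := integrable_le_measure pos_le mp_int.
have neg_int := integrable_le_measure neg_le mn_int.
have nu_pos_neg A : measurable A -> (nu A = pos A - neg A)%E.
  move=> mA; rewrite (jordan_decomp (svalP N) mA).
  by rewrite /cadd /= cscaleN1.
have : (\int[measure_add pos mn]_x (f x)%:E =
        \int[measure_add neg mp]_x (f x)%:E)%E.
  apply: eq_measure_integral => A mA _.
  apply: etrans (measure_addE pos mn A) _.
  apply: etrans _ (esym (measure_addE neg mp A)).
  have pos_fin : pos A \is a fin_num by rewrite fin_num_measure.
  have neg_fin : neg A \is a fin_num by rewrite fin_num_measure.
  have := nu_pos_neg A mA; rewrite nu_mp_mn //.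
  rewrite -(fineK (mp_fin _ mA)) -(fineK (mn_fin _ mA)) -(fineK pos_fin).
  rewrite -(fineK neg_fin) -!EFinN -!EFinD => -[E]; congr _%:E; lra.
have mEf : measurable_fun setT (EFin \o f) by exact/measurable_EFinP.
have fin (m : {measure set T -> \bar R}) : m.-integrable setT (EFin \o f) ->
    (\int[m]_x (f x)%:E = (Rintegral m setT f)%:E)%E.
  by move=> mfi; rewrite fineK // integrable_fin_num.
rewrite !integral_measure_add // !fin // -!EFinD => -[E].
transitivity (Rintegral mp setT f - Rintegral mn setT f).
  by rewrite -/pos -/neg; lra.
rewrite mpI mnI -sumrB; apply: eq_bigr => j _; rewrite -mulrBl.
by rewrite max_sub.
Qed.

End linear_combination.

(** * Supports of combinations and of densities *)

Section supports_of_densities.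
Context (R : realType) (T : ptopologicalType).

(** A point outside all the supports has, for each of the finitely many [j], a
    neighbourhood on which [mu_ j] is zero; [nu] is zero on their
    intersection. *)
Lemma supp_sub_bigcup (V : nmodType) (nu : set (borel T) -> V) r
    (mu_ : 'I_r -> set (borel T) -> \bar R) :
  (forall A, measurable A -> (forall j, mu_ j A = 0%E) -> nu A = 0) ->
  supp nu `<=` \bigcup_j supp (mu_ j).
Proof.
move=> nu0 x nux; apply: contrapT => mux.
have /choice[U UP] j : exists U : set T, [/\ open U, U x &
    forall A : set (borel T), measurable A -> mu_ j (A `&` U) = 0%E].
  have /existsNP[U /not_implyP[oU /not_implyP[Ux U0]]] : ~ supp (mu_ j) x.
    by apply: contra_not mux; exists j.
  exists U; split=> // A mA; apply: contra_notP U0 => AU.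
  by exists A.
have : nbhs x [set y | forall j, U j y].
  by apply: filter_forall => j; have [oU Ux _] := UP j; exact: open_nbhs_nbhs.
rewrite nbhsE => -[W [oW Wx] WU].
have [A mA] := nux W oW Wx; apply; apply: nu0 => [|j].
  by apply: measurableI => //; exact: open_borel.
have [_ _ /(_ (A `&` W))] := UP j.
rewrite -setIA (setIidl (_ : W `<=` U j)) => [|y /WU/(_ j)//].
by apply; apply: measurableI => //; exact: open_borel.
Qed.

Variables (mu : {measure set (borel T) -> \bar R}) (h : borel T -> R).
Hypothesis h_ge0 : forall x, 0 <= h x.

(** The product [g * h] is zero almost everywhere, so [h] is zero almost
    everywhere on the open set where [g] is not zero; this set then avoids the
    support of the density. *)
Lemma vanish_on_supp_density (g : borel T -> R) :
  measurable_fun setT h -> (forall x, 0 <= g x) -> continuous (g : T -> R) ->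
  mu.-integrable setT (fun x => (g x * h x)%:E) ->
  Rintegral mu setT (fun x => g x * h x) = 0 ->
  forall x, supp (density mu h) x -> g x = 0.
Proof.
move=> mh g_ge0 cg intgh gh0 x suppx; apply/eqP/negP => /negP gx.
have g_open : open ([set x | g x != 0] : set T).
  rewrite (_ : [set _ | _] = (g : T -> R) @^-1` ~` [set 0]).
    by apply: open_comp => [y _|]; [exact: cg|exact/closed_openC/closed_eq].
  by apply/seteqP; split=> y /= /eqP.
have [A mA] := suppx _ g_open gx; apply.
have mU : measurable ([set x | g x != 0] : set (borel T)) by exact: open_borel.
have mAU := measurableI _ _ mA mU.
have /integrableP[gh_meas _] := intgh.
have : ae_eq mu setT (fun x => (g x * h x)%:E) (cst 0%E).
  apply/ae_eq_integral_abs => //.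
  rewrite -[RHS](congr1 EFin gh0) fineK ?integrable_fin_num //.
  apply: eq_integral => y _ /=.
  by rewrite ger0_norm // mulr_ge0.
move=> gh_ae; rewrite /density (@ae_eq_integral _ _ _ mu _ (cst 0%E)) //.
- by rewrite integral0.
- exact/measurable_EFinP/measurable_funTS.
- apply: filterS gh_ae => y /(_ Logic.I) [/eqP]; rewrite mulf_eq0.
  by move=> ghy [_ /= /negbTE gy]; move: ghy; rewrite gy /= => /eqP ->.
Qed.

(** The whole space is the complement of an empty support, so the density has
    total mass zero and [h] is zero almost everywhere. *)
Lemma Rintegral_density_supp0 (f : borel T -> R) :
  @second_countable T ->
  mu.-integrable setT (EFin \o h) -> measurable_fun setT f ->
  supp (density mu h) = set0 ->
  Rintegral mu setT (fun x => f x * h x) = 0.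
Proof.
move=> T2 inth mf supp0.
have := @charge_setC_supp R T T2 (induced_charge inth) setT measurableT.
rewrite (_ : supp _ = set0) // setC0 => /(_ (@subset_refl _ _)) h0.
have /integrableP[h_meas _] := inth.
have h_ae : ae_eq mu setT (EFin \o h) (cst 0%E).
  apply/ae_eq_integral_abs => //; rewrite -[RHS]h0.
  by apply: eq_integral => y _; rewrite /= ger0_norm.
rewrite /Rintegral (@ae_eq_integral _ _ _ mu _ (cst 0%E)) ?integral0 //.
  apply/measurable_EFinP/measurable_funM => //.
  exact/measurable_EFinP.
by apply: filterS h_ae => y /(_ Logic.I) [hy] _; rewrite /= hy mulr0.
Qed.

End supports_of_densities.

(** * The kernel of a Gram matrix *)

Section kernel.
Context {K : fieldType}.

Lemma semilinear_sum (U W : lmodType K) (theta : K -> K) (f : U -> W) :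
  {morph f : x y / x + y} -> (forall c x, f (c *: x) = theta c *: f x) ->
  forall m (c : 'I_m -> K) (e : 'I_m -> U),
  f (\sum_i c i *: e i) = \sum_i theta (c i) *: f (e i).
Proof.
move=> fD fZ m c e.
have f0 : f 0 = 0 by apply: (addIr (f 0)); rewrite add0r -fD addr0.
by rewrite (big_morph f fD f0); apply: eq_bigr => i _; rewrite fZ.
Qed.

(** The pairing of [B' i] with a combination of the [B j] is the [i]-th entry of
    the matrix product.  The twist [theta] is the identity for real scalars and
    the conjugation for complex ones. *)
Lemma kernel_in_gram (L : comAlgType K) (theta : K -> K) (form : L -> L -> K)
    (V V' : set L) m m' (B : 'I_m -> L) (B' : 'I_m' -> L) :
  is_basis V B -> is_basis V' B' ->
  (forall p, {morph form^~ p : q1 q2 / q1 + q2}) ->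
  (forall c q p, form (c *: q) p = theta c * form q p) ->
  (forall q, {morph form q : p1 p2 / p1 + p2}) ->
  (forall c q p, form q (c *: p) = c * form q p) ->
  kernel_in B (gram form B' B) =
  [set p | V p /\ forall q, V' q -> form q p = 0].
Proof.
move=> [-> _] [-> _] formDl formZl formDr formZr.
have formE (c : 'cV[K]_m) i :
    form (B' i) (\sum_j c j 0 *: B j) = (gram form B' B *m c) i 0.
  rewrite (@semilinear_sum L K^o id) // mxE; apply: eq_bigr => j _.
  by rewrite mxE [LHS]mulrC.
rewrite eqEsubset; split=> [_ [c /= Hc <-]|_ [[c _ <-] /= pker]].
  split; first by exists (fun j => c j 0).
  move=> _ [a _ <-].
  rewrite (@semilinear_sum L K^o theta (form^~ _)) // big1 // => i _.
  by rewrite formE Hc mxE; exact: mulr0.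
exists (\col_j c j) => /=; last by apply: eq_bigr => j _; rewrite mxE.
apply/colP => i; rewrite -formE !mxE.
under eq_bigr do rewrite mxE.
apply: pker; exists (fun k => (k == i)%:R) => //.
rewrite (bigD1 i) //= eqxx scale1r big1 ?addr0 // => k /negbTE ->.
by rewrite scale0r.
Qed.

End kernel.

(** * Polynomial functions on the affine space *)

Lemma continuous_exprn (K : numFieldType) (T : topologicalType) (f : T -> K) k :
  continuous f -> continuous (fun x => f x ^+ k).
Proof.
move=> cf; elim: k => [|k IH] x.
  by under eq_fun do rewrite expr0; exact: cvg_cst.
under eq_fun do rewrite exprS.
exact: continuousM (cf x) (IH x).
Qed.

Lemma continuous_borel_measurable (R : realType) (T : ptopologicalType)
    (f : T -> R) :
  continuous f -> measurable_fun setT (f : borel T -> R).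
Proof.
move=> /continuousP cf; apply: (measurability _ (RGenOpens.measurableE R)).
move=> _ [_ [a [b ->] <-]]; rewrite setTI; apply: open_borel.
exact/cf/interval_open.
Qed.

Section affine.
Context (R : realType) (n : nat).
Implicit Types p q : mpoly n R.

Lemma pevalM p q x : peval (p * q) x = peval p x * peval q x.
Proof. exact: mevalM. Qed.

Lemma pevalD p q x : peval (p + q) x = peval p x + peval q x.
Proof. exact: mevalD. Qed.

Lemma pevalZ c p x : peval (c *: p) x = c * peval p x.
Proof. exact: mevalZ. Qed.

Lemma peval1 x : peval (1 : mpoly n R) x = 1.
Proof. exact: meval1. Qed.

Lemma peval_continuous p : continuous (peval p).
Proof.
have E : peval p = fun x =>
    \sum_(m <- mpoly.msupp p) mpoly.mcoeff m p * \prod_i x 0 i ^+ m i.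
  by apply/funext => x; exact: mevalE.
rewrite E; apply: (@continuous_big _ _ +%R) => [|m _].
  exact: add_continuous.
have cprod : continuous (fun x : 'rV[R]_n => \prod_i x 0 i ^+ m i).
  apply: (@continuous_big R _ *%R 1 xpredT _ _ _
           (fun i (x : 'rV[R]_n) => x 0 i ^+ m i)) => [|i _].
    exact: mul_continuous.
  exact/continuous_exprn/coord_continuous.
move=> x; apply: (@continuousM _ _ (cst _) _ x); last exact: cprod.
exact: cst_continuous.
Qed.

End affine.

(** * The affine case *)

Lemma affine_case (R : realType) (n : nat)
    (F : nat -> set (mpoly n R)) (r : nat) (lambda : 'I_r -> R)
    (mu_ : 'I_r -> {measure set (borel 'rV[R]_n) -> \bar R})
    (mu : {charge set (borel 'rV[R]_n) -> \bar R})
    (delta : nat) (h : 'I_r -> mpoly n R) :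
  is_filtration F ->
  (forall j, lambda j != 0) ->
  (forall j (p : mpoly n R),
    (mu_ j).-integrable setT (fun x => (peval p x)%:E)) ->
  (forall A, measurable A ->
    mu A = (\sum_(j < r) (lambda j)%:E * mu_ j A)%E) ->
  (forall j, F delta (h j)) ->
  (forall j x, 0 <= peval (h j) x) ->
  (forall j k, supp (density (mu_ k) (peval (h j))) =
    if k == j then supp (mu_ k) else set0) ->
  forall (d m m' : nat)
    (B : 'I_m -> mpoly n R) (B' : 'I_m' -> mpoly n R),
  is_basis (F d) B ->
  is_basis (F (d + delta)%N) B' ->
  let sigma (p : mpoly n R) := charge_integral mu (peval p) in
  let H := gram (circ_form id sigma) B' B in
  vanishing_ideal (@peval n R) (supp mu) `&` F d = kernel_in B H.
Proof.
move=> filtF lambda0 mom muE hF h_ge0 hsupp d m m' B B' basisB basisB' sigma H.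
have T2 : @second_countable 'rV[R]_n.
  by apply: second_countable_mx; exact: second_countable_real.
have mpeval p : measurable_fun setT (peval p : borel 'rV[R]_n -> R).
  by apply: continuous_borel_measurable; exact: peval_continuous.
have mu_fin j : (mu_ j setT < +oo)%E.
  have /integrableP[_] := mom j 1.
  by under eq_integral do rewrite peval1 /= normr1; rewrite integral_cst ?mul1e.
have sigmaE p : sigma p = \sum_j lambda j * Rintegral (mu_ j) setT (peval p).
  exact: (charge_integral_combination mu_fin muE (mpeval p) (mom^~ p)).
have sigmaD : {morph sigma : p q / p + q}.
  move=> p q; rewrite !sigmaE -big_split; apply: eq_bigr => j _ /=.
  rewrite -mulrDr -(RintegralD measurableT (mom j p) (mom j q)).
  by congr (_ * _); apply: eq_Rintegral => x _; exact: pevalD.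
have sigmaZ c p : sigma (c *: p) = c * sigma p.
  rewrite !sigmaE mulr_sumr; apply: eq_bigr => j _ /=.
  rewrite mulrCA -(RintegralZl _ measurableT (mom j p)).
  by congr (_ * _); apply: eq_Rintegral => x _; exact: pevalZ.
rewrite /H (kernel_in_gram (theta := id) basisB basisB') /circ_form; first last.
- by move=> c q p; rewrite -scalerAr sigmaZ.
- by move=> q p1 p2; rewrite mulrDr sigmaD.
- by move=> c q p; rewrite -scalerAl sigmaZ.
- by move=> p q1 q2; rewrite mulrDl sigmaD.
rewrite eqEsubset; split=> [p [pI Fp]|p [Fp pker]].
  split=> // q _; apply: charge_integral_vanish => // x /pI px.
  by rewrite pevalM px mulr0.
split=> // x /(supp_sub_bigcup (mu_ := mu_))[|j _ suppx].
  by move=> A mA mu0; rewrite muE // big1 // => j _; rewrite mu0 mule0.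
have pE : peval (p * h j * p) = fun y => peval p y ^+ 2 * peval (h j) y.
  by apply/funext => y; rewrite !pevalM; ring.
(* The test element [p * h j] isolates the [j]-th component. *)
have := pker (p * h j) (filtrationM filtF Fp (hF j)).
rewrite sigmaE (bigD1 j) //= big1 ?addr0; last first.
  move=> k kj; rewrite pE Rintegral_density_supp0 ?mulr0 //.
  - exact: mom.
  - exact: measurable_funX.
  - by rewrite hsupp (negbTE kj).
move=> /eqP; rewrite mulf_eq0 (negbTE (lambda0 j)) pE /=.
move=> /eqP int0; apply/eqP; rewrite -sqrf_eq0; apply/eqP.
apply: (vanish_on_supp_density (mu := mu_ j) (h_ge0 j)
         (g := fun y => peval p y ^+ 2)) => //.
- by move=> y; exact: sqr_ge0.
- exact/continuous_exprn/peval_continuous.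
- by have := mom j (p * h j * p); rewrite pE.
- by rewrite hsupp eqxx.
Qed.

(** * Laurent polynomials on the torus *)

Section laurent_polynomials.
Context (R : realType) (n : nat).
Local Notation C := (Cplx R).
Local Notation M := 'rV[int]_n.
Implicit Types (p q : laurent n C) (z : torus n R).

Let monomial z (a : M) : C := \prod_(i < n) (set_val z 0 i) ^ (a 0 i).

Lemma torus_norm1 z i : `|set_val z 0 i| = 1.
Proof. exact: (set_valP z). Qed.

Lemma torus_neq0 z i : set_val z 0 i != 0.
Proof. by rewrite -normr_eq0 torus_norm1 oner_eq0. Qed.

Let monomialD z (a b : M) : monomial z (a + b) = monomial z a * monomial z b.
Proof.
rewrite -big_split; apply: eq_bigr => i _ /=.
by rewrite mxE expfzDr // torus_neq0.
Qed.

Let monomialN z (a : M) : monomial z (- a) = (monomial z a)^*%R.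
Proof.
rewrite rmorph_prod; apply: eq_bigr => i _ /=.
by rewrite mxE -exprz_inv fmorphXz invC_norm torus_norm1 expr1n invr1 mul1r.
Qed.

(** Two Laurent polynomials can only be added termwise over a common finite set
    of exponents. *)
Lemma leval_widen (d : {fset M}) p z : (msupp p `<=` d)%fset ->
  leval p z = \sum_(a <- d) mcoeff a p * monomial z a.
Proof.
move=> pd; rewrite /leval (big_fset_incl _ pd) // => a _ /mcoeff_outdom ->.
by rewrite mul0r.
Qed.

Lemma levalD p q z : leval (p + q) z = leval p z + leval q z.
Proof.
rewrite (leval_widen _ (msuppD_le p q)).
rewrite (leval_widen _ (fsubsetUl (msupp p) (msupp q))).
rewrite (leval_widen _ (fsubsetUr (msupp p) (msupp q))) -big_split.
by apply: eq_bigr => a _ /=; rewrite mcoeffD mulrDl.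
Qed.

Lemma levalZ c p z : leval (c *: p) z = c * leval p z.
Proof.
rewrite (leval_widen _ (msuppZ_le c p)) mulr_sumr; apply: eq_bigr => a _.
by rewrite (mcoeffZ c p a) mulrA.
Qed.

Lemma leval0 z : leval (0 : laurent n C) z = 0.
Proof. by rewrite /leval msupp0 big_seq_fset0. Qed.

Let levalU (a : M) c z : leval (mkmalgU a c : laurent n C) z = c * monomial z a.
Proof. by rewrite (leval_widen _ msuppU_le) big_seq_fset1 mcoeffUU. Qed.

Lemma leval_sum I (s : seq I) (f : I -> laurent n C) z :
  leval (\sum_(i <- s) f i) z = \sum_(i <- s) leval (f i) z.
Proof.
elim: s => [|i s IH]; first by rewrite !big_nil leval0.
by rewrite !big_cons levalD IH. Qed.

Lemma leval1 z : leval (1 : laurent n C) z = 1.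
Proof.
rewrite [1]/(laurent_one n C) /laurent_one levalU mul1r /monomial.
by rewrite big1 // => i _; rewrite mxE expr0z.
Qed.

Lemma levalM p q z : leval (p * q) z = leval p z * leval q z.
Proof.
rewrite [p * q]/(laurent_mul p q) /laurent_mul leval_sum big_distrl.
apply: eq_bigr => a _ /=; rewrite leval_sum big_distrr.
by apply: eq_bigr => b _ /=; rewrite levalU monomialD mulrACA.
Qed.

(** On the torus conjugation inverts the coordinates, so that the involution
    induces the conjugation of the values. *)
Lemma leval_circ p z : leval (laurent_circ p) z = (leval p z)^*%R.
Proof.
rewrite /laurent_circ leval_sum rmorph_sum; apply: eq_bigr => a _ /=.
by rewrite levalU monomialN rmorphM.
Qed.

Let circ_widen (d : {fset M}) p : (msupp p `<=` d)%fset ->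
  laurent_circ p = \sum_(a <- d) mkmalgU (- a) ((mcoeff a p)^*)%R.
Proof.
move=> pd; rewrite /laurent_circ (big_fset_incl _ pd) //= => a _.
by move=> /mcoeff_outdom ->; rewrite rmorph0 monalgU0.
Qed.

Lemma laurent_circD : {morph @laurent_circ n R : p q / p + q}.
Proof.
move=> p q; rewrite (circ_widen (msuppD_le p q)).
rewrite (circ_widen (fsubsetUl (msupp p) (msupp q))).
rewrite (circ_widen (fsubsetUr (msupp p) (msupp q))) -big_split.
by apply: eq_bigr => a _ /=; rewrite mcoeffD rmorphD monalgUD.
Qed.

Lemma laurent_circZ c p : laurent_circ (c *: p) = c^*%R *: laurent_circ p.
Proof.
rewrite (circ_widen (msuppZ_le c p)) [in RHS]/laurent_circ scaler_sumr.
apply: eq_bigr => a _; rewrite (mcoeffZ c p a) rmorphM.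
apply/malgP => k; rewrite (mcoeffZ (c^*)%R (mkmalgU (- a) (mcoeff a p)^*%R) k).
rewrite [LHS]mcoeffU -mulrnAr; congr (_ * _); exact/esym/mcoeffU.
Qed.

Lemma continuous_exprz (T : topologicalType) (f : T -> C) (k : int) :
  (forall x, f x != 0) -> continuous f -> continuous (fun x => f x ^ k).
Proof.
move=> f0 cf; case: k => k; first exact: continuous_exprn.
move=> x; apply: (@continuousV _ _ (fun x => f x ^+ k.+1)).
  by rewrite expf_neq0.
exact: continuous_exprn.
Qed.

Lemma leval_continuous p : continuous (leval p).
Proof.
apply: (@continuous_big _ _ +%R) => [|a _]; first exact: add_continuous.
have cprod : continuous (monomial^~ a).
  apply: (@continuous_big C _ *%R 1 xpredT _ _ _
           (fun i z => (set_val z 0 i) ^ (a 0 i))) => [|i _].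
    exact: mul_continuous.
  apply: continuous_exprz; first by move=> z; exact: torus_neq0.
  move=> z; apply: (@continuous_comp _ _ _ set_val (fun w : 'rV[C]_n => w 0 i)).
    exact: initial_continuous.
  exact: coord_continuous.
move=> z; apply: (@continuousM _ _ (cst _) _ z); last exact: cprod.
exact: cst_continuous.
Qed.

Lemma complex_part_continuous (T : topologicalType) (g : {additive R[i] -> R})
    (f : T -> C) :
  (forall w : R[i], (`|g w|%:C)%C <= `|w|) ->
  continuous f -> continuous (fun x => g (f x)).
Proof.
move=> gle cf x; apply/cvgrPdist_lt => e e0.
have e0' : (0 : C) < (e%:C)%C by rewrite ltcR.
have /cvgrPdist_lt/(_ _ e0') := cf x.
apply: filterS => y; rewrite -raddfB -ltcR; exact: le_lt_trans (gle _).
Qed.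

Lemma normc_ge_Im (w : R[i]) : (`|complex.Im w|%:C)%C <= `|w|.
Proof.
by case: w => a b; simpc; rewrite -sqrtr_sqr ler_wsqrtr // lerDr sqr_ge0.
Qed.

Lemma leval_Re_measurable p :
  measurable_fun setT
    ((fun z => complex.Re (leval p z)) : borel (torus n R) -> R).
Proof.
apply: continuous_borel_measurable.
exact: (complex_part_continuous (g := @complex.Re R) (@normc_ge_Re R)
         (@leval_continuous p)).
Qed.

Lemma leval_Im_measurable p :
  measurable_fun setT
    ((fun z => complex.Im (leval p z)) : borel (torus n R) -> R).
Proof.
apply: continuous_borel_measurable.
exact: (complex_part_continuous (g := @complex.Im R) normc_ge_Im
         (@leval_continuous p)).
Qed.

End laurent_polynomials.

(** * Integrals against complex measures *)

Section complex_integrals.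
Context (R : realType).
Local Notation C := (Cplx R).

Section measurable.
Context d (T : measurableType d).
Implicit Types (f g : T -> C).

(** The total mass [cdensity mu f setT] of the measure with density [f] is the
    integral of the complex function [f]. *)
Lemma cdensity_setTD (mu : {measure set T -> \bar R}) f g :
  cintegrable mu f -> cintegrable mu g ->
  cdensity mu (fun x => f x + g x) setT =
  cdensity mu f setT + cdensity mu g setT.
Proof.
move=> [fr fi] [gr gi]; rewrite /cdensity; simpc.
rewrite -(RintegralD measurableT fr gr) -(RintegralD measurableT fi gi).
by congr (_ +i* _)%C; apply: eq_Rintegral => x _; rewrite raddfD.
Qed.

Lemma cdensity_setTZ (mu : {measure set T -> \bar R}) (c : C) f :
  cintegrable mu f ->
  cdensity mu (fun x => c * f x) setT = c * cdensity mu f setT.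
Proof.
move=> [fr fi]; case: c => a b; rewrite /cdensity; simpc.
have Z (k : R) (g : T -> R) : mu.-integrable setT (EFin \o g) ->
    mu.-integrable setT (EFin \o (fun x => k * g x)).
  by move=> ig; exact: (integrableZl measurableT k ig).
rewrite -!(RintegralZl _ measurableT fr) -!(RintegralZl _ measurableT fi).
rewrite -(RintegralB measurableT (Z _ _ fr) (Z _ _ fi)).
rewrite -(RintegralD measurableT (Z _ _ fi) (Z _ _ fr)).
by congr (_ +i* _)%C; apply: eq_Rintegral => x _; case: (f x).
Qed.

(** The masses of the [mu_ j] are real, so the real and imaginary parts of [mu]
    are the combinations whose coefficients are the real and imaginary parts of
    those of [mu]. *)
Lemma cmeasure_integral_combination r (lambda : 'I_r -> C)
    (mu_ : 'I_r -> {measure set T -> \bar R}) (mu : complex_measure T R) f :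
  (forall j, (mu_ j setT < +oo)%E) ->
  (forall A, measurable A ->
    mu A = \sum_j lambda j * real_complex R (fine (mu_ j A))) ->
  measurable_fun setT (fun x => complex.Re (f x)) ->
  measurable_fun setT (fun x => complex.Im (f x)) ->
  (forall j, cintegrable (mu_ j) f) ->
  cmeasure_integral mu f = \sum_j lambda j * cdensity (mu_ j) f setT.
Proof.
move=> mu_fin muE mfr mfi intf.
have mu_fin_num j A : measurable A -> mu_ j A \is a fin_num.
  exact: finite_measure_fin_num.
have reE A : measurable A ->
    (cmeasure_re mu A = \sum_j (complex.Re (lambda j))%:E * mu_ j A)%E.
  move=> mA; rewrite /cmeasure_re muE // raddf_sum -sumEFin; apply: eq_bigr.
  move=> j _; rewrite -[in RHS](fineK (mu_fin_num j A mA)) -EFinM.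
  by case: (lambda j) => a b; simpc.
have imE A : measurable A ->
    (cmeasure_im mu A = \sum_j (complex.Im (lambda j))%:E * mu_ j A)%E.
  move=> mA; rewrite /cmeasure_im muE // raddf_sum -sumEFin; apply: eq_bigr.
  move=> j _; rewrite -[in RHS](fineK (mu_fin_num j A mA)) -EFinM.
  by case: (lambda j) => a b; simpc.
have fr j := (intf j).1; have fi j := (intf j).2.
rewrite /cmeasure_integral.
rewrite (charge_integral_combination mu_fin reE mfr fr).
rewrite (charge_integral_combination mu_fin reE mfi fi).
rewrite (charge_integral_combination mu_fin imE mfr fr).
rewrite (charge_integral_combination mu_fin imE mfi fi).
rewrite -sumrB -big_split /=.
apply/eqP; rewrite eq_complex !raddf_sum /=; apply/andP; split; apply/eqP.
  by apply: eq_bigr => j _; rewrite /cdensity; case: (lambda j) => a b; simpc.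
by apply: eq_bigr => j _; rewrite /cdensity; case: (lambda j) => a b; simpc.
Qed.

End measurable.

Section topological.
Context (T : ptopologicalType).

Lemma supp_cmeasure_re (mu : complex_measure (borel T) R) :
  supp (cmeasure_re mu) `<=` supp mu.
Proof.
move=> x xre U oU Ux; have [A mA muA] := xre U oU Ux.
by exists A => //; apply: contra_not muA => muA; rewrite /cmeasure_re muA.
Qed.

Lemma supp_cmeasure_im (mu : complex_measure (borel T) R) :
  supp (cmeasure_im mu) `<=` supp mu.
Proof.
move=> x xim U oU Ux; have [A mA muA] := xim U oU Ux.
by exists A => //; apply: contra_not muA => muA; rewrite /cmeasure_im muA.
Qed.

Lemma cmeasure_integral_vanish (mu : complex_measure (borel T) R)
    (f : borel T -> C) :
  @second_countable T ->
  measurable_fun setT (fun x => complex.Re (f x)) ->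
  measurable_fun setT (fun x => complex.Im (f x)) ->
  (forall x, supp mu x -> f x = 0) -> cmeasure_integral mu f = 0.
Proof.
move=> T2 mfr mfi f0; rewrite /cmeasure_integral.
rewrite !charge_integral_vanish ?subr0 ?addr0 //.
- by move=> x /supp_cmeasure_im/f0 ->.
- by move=> x /supp_cmeasure_re/f0 ->.
- by move=> x /supp_cmeasure_im/f0 ->.
- by move=> x /supp_cmeasure_re/f0 ->.
Qed.

(** The imaginary part of a nonnegative complex number is zero, which reduces
    complex densities to real ones. *)
Lemma supp_cdensity (mu : {measure set (borel T) -> \bar R})
    (h : borel T -> C) :
  cintegrable mu h -> (forall x, 0 <= h x) ->
  supp (cdensity mu h) = supp (density mu (fun x => complex.Re (h x))).
Proof.
move=> [hr _] h_ge0.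
have cdensityE (A : set (borel T)) : measurable A ->
    (cdensity mu h A = 0) <-> (density mu (fun x => complex.Re (h x)) A = 0%E).
  move=> mA; rewrite /cdensity /density.
  have -> : Rintegral mu A (fun x => complex.Im (h x)) = 0.
    rewrite (@eq_Rintegral _ _ _ mu A (cst 0)).
      by rewrite /Rintegral integral0.
    by move=> x _; rewrite ger0_Im.
  rewrite /Rintegral; split=> [[h0]|->//].
  rewrite -[LHS]fineK ?h0 // integrable_fin_num //.
  exact: (integrableS measurableT mA (@subsetT _ _) hr).
rewrite eqEsubset; split=> x suppx U oU Ux; have [A mA AU] := suppx U oU Ux;
  exists A => //; apply: contra_not AU => AU; apply/cdensityE => //;
  by apply: measurableI => //; exact: open_borel.
Qed.

End topological.
End complex_integrals.

(** * The trigonometric case *)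

Lemma trigonometric_case (R : realType) (n : nat)
    (F : nat -> set (laurent n (Cplx R))) (r : nat)
    (lambda : 'I_r -> Cplx R)
    (mu_ : 'I_r -> {measure set (borel (torus n R)) -> \bar R})
    (mu : complex_measure (borel (torus n R)) R)
    (delta : nat) (h : 'I_r -> laurent n (Cplx R)) :
  is_filtration F ->
  (forall j, lambda j != 0) ->
  (forall j (p : laurent n (Cplx R)), cintegrable (mu_ j) (leval p)) ->
  (forall A, measurable A ->
    mu A = \sum_(j < r) lambda j * real_complex R (fine (mu_ j A))) ->
  (forall j, F delta (h j)) ->
  (forall j z, 0 <= leval (h j) z) ->
  (forall j k, supp (cdensity (mu_ k) (leval (h j))) =
    if k == j then supp (mu_ k) else set0) ->
  forall (d m m' : nat)
    (B : 'I_m -> laurent n (Cplx R)) (B' : 'I_m' -> laurent n (Cplx R)),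
  is_basis (F d) B ->
  is_basis (F (d + delta)%N) B' ->
  let sigma (p : laurent n (Cplx R)) := cmeasure_integral mu (leval p) in
  let H := gram (circ_form (@laurent_circ n R) sigma) B' B in
  vanishing_ideal (@leval n R) (supp mu) `&` F d = kernel_in B H.
Proof.
move=> filtF lambda0 mom muE hF h_ge0 hsupp d m m' B B' basisB basisB' sigma H.
have T2 : @second_countable (torus n R).
  apply: second_countable_set_type; apply: second_countable_mx.
  exact: second_countable_complex.
have mre := @leval_Re_measurable R n; have mim := @leval_Im_measurable R n.
have mu_fin j : (mu_ j setT < +oo)%E.
  have [/integrableP[_ +] _] := mom j 1.
  by under eq_integral do rewrite leval1 /= normr1; rewrite integral_cst ?mul1e.
have sigmaE p : sigma p = \sum_j lambda j * cdensity (mu_ j) (leval p) setT.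
  exact: (cmeasure_integral_combination mu_fin muE (mre p) (mim p) (mom^~ p)).
have sigmaD : {morph sigma : p q / p + q}.
  move=> p q; rewrite !sigmaE -big_split; apply: eq_bigr => j _ /=.
  rewrite -mulrDr -(cdensity_setTD (mom j p) (mom j q)).
  by congr (_ * cdensity _ _ _); apply/funext => z; exact: levalD.
have sigmaZ c p : sigma (c *: p) = c * sigma p.
  rewrite !sigmaE mulr_sumr; apply: eq_bigr => j _ /=.
  rewrite mulrCA -(cdensity_setTZ _ (mom j p)).
  by congr (_ * cdensity _ _ _); apply/funext => z; exact: levalZ.
rewrite /H (kernel_in_gram (theta := Num.conj) basisB basisB') /circ_form;
  first last.
- by move=> c q p; rewrite -scalerAr sigmaZ.
- by move=> q p1 p2; rewrite mulrDr sigmaD.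
- by move=> c q p; rewrite laurent_circZ -scalerAl sigmaZ.
- by move=> p q1 q2; rewrite laurent_circD mulrDl sigmaD.
rewrite eqEsubset; split=> [p [pI Fp]|p [Fp pker]].
  split=> // q _; apply: cmeasure_integral_vanish => // z /pI pz.
  by rewrite levalM pz mulr0.
split=> // z /(supp_sub_bigcup (mu_ := mu_))[|j _ suppz].
  by move=> A mA mu0; rewrite muE // big1 // => j _; rewrite mu0 mulr0.
(* The values of [circ (p * h j) * p] are |p|^2 h_j = g w. *)
pose g (y : torus n R) : R := complex.Re `|leval p y| ^+ 2.
pose w (y : torus n R) : R := complex.Re (leval (h j) y).
have w_ge0 y : 0 <= w y by have := h_ge0 j y; rewrite lecE => /andP[].
have pE : leval (laurent_circ (p * h j) * p) = fun y => ((g y * w y)%:C)%C.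
  apply/funext => y; rewrite levalM leval_circ levalM rmorphM.
  rewrite /= (conj_Creal (ger0_real (h_ge0 j y))) mulrAC -normCKC.
  by rewrite rmorphM rmorphXn /= !RRe_real ?normr_real ?ger0_real.
have densityE k :
    supp (density (mu_ k) w) = if k == j then supp (mu_ k) else set0.
  by rewrite -hsupp supp_cdensity.
have cdensityE k : cdensity (mu_ k) (leval (laurent_circ (p * h j) * p)) setT =
    ((Rintegral (mu_ k) setT (fun y => g y * w y))%:C)%C.
  rewrite pE /cdensity; congr (_ +i* _)%C.
  by rewrite /Rintegral integral0.
have cg : continuous g.
  have -> : g = fun y => complex.Re (leval (laurent_circ p * p) y).
    apply/funext => y; rewrite levalM leval_circ -normCKC /g.
    by rewrite -(RRe_real (normr_real (leval p y))) -rmorphXn /=.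
  exact: (complex_part_continuous (g := @complex.Re R) (@normc_ge_Re R)
           (@leval_continuous _ _ _)).
have mg := continuous_borel_measurable cg.
(* The test element [p * h j] isolates the [j]-th component. *)
have := pker (p * h j) (filtrationM filtF Fp (hF j)).
rewrite sigmaE (bigD1 j) //= big1 ?addr0; last first.
  move=> k kj; rewrite cdensityE (Rintegral_density_supp0 w_ge0) ?mulr0 //.
  - exact: (mom k (h j)).1.
  - by rewrite densityE (negbTE kj).
move=> /eqP; rewrite mulf_eq0 (negbTE (lambda0 j)) cdensityE /=.
move=> /eqP[int0].
have gz : g z = 0.
  apply: (vanish_on_supp_density (mu := mu_ j) w_ge0 (g := g)) => //.
  - exact: mre.
  - by move=> y; exact: sqr_ge0.
  - by have := (mom j (laurent_circ (p * h j) * p)).1; rewrite pE.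
  - by rewrite densityE eqxx.
apply/eqP; rewrite -normr_eq0 -(RRe_real (normr_real _)).
by move: gz => /eqP; rewrite sqrf_eq0 => /eqP ->.
Qed.

Theorem theorem4p16 (R : realType) (n : nat) :
  (* affine case *)
  (forall (F : nat -> set (mpoly n R)) (r : nat) (lambda : 'I_r -> R)
      (mu_ : 'I_r -> {measure set (borel 'rV[R]_n) -> \bar R})
      (mu : {charge set (borel 'rV[R]_n) -> \bar R})
      (delta : nat) (h : 'I_r -> mpoly n R),
    is_filtration F ->
    (forall j, lambda j != 0) ->
    (forall j (p : mpoly n R),
      (mu_ j).-integrable setT (fun x => (peval p x)%:E)) ->
    (forall A, measurable A ->
      mu A = (\sum_(j < r) (lambda j)%:E * mu_ j A)%E) ->
    (forall j, F delta (h j)) ->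
    (forall j x, 0 <= peval (h j) x) ->
    (forall j k, supp (density (mu_ k) (peval (h j))) =
      if k == j then supp (mu_ k) else set0) ->
    forall (d m m' : nat)
      (B : 'I_m -> mpoly n R) (B' : 'I_m' -> mpoly n R),
    is_basis (F d) B ->
    is_basis (F (d + delta)%N) B' ->
    let sigma (p : mpoly n R) := charge_integral mu (peval p) in
    let H := gram (circ_form id sigma) B' B in
    vanishing_ideal (@peval n R) (supp mu) `&` F d = kernel_in B H)
  /\
  (* trigonometric case *)
  (forall (F : nat -> set (laurent n (Cplx R))) (r : nat)
      (lambda : 'I_r -> Cplx R)
      (mu_ : 'I_r -> {measure set (borel (torus n R)) -> \bar R})
      (mu : complex_measure (borel (torus n R)) R)
      (delta : nat) (h : 'I_r -> laurent n (Cplx R)),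
    is_filtration F ->
    (forall j, lambda j != 0) ->
    (forall j (p : laurent n (Cplx R)), cintegrable (mu_ j) (leval p)) ->
    (forall A, measurable A ->
      mu A = \sum_(j < r) lambda j * real_complex R (fine (mu_ j A))) ->
    (forall j, F delta (h j)) ->
    (forall j z, 0 <= leval (h j) z) ->
    (forall j k, supp (cdensity (mu_ k) (leval (h j))) =
      if k == j then supp (mu_ k) else set0) ->
    forall (d m m' : nat)
      (B : 'I_m -> laurent n (Cplx R)) (B' : 'I_m' -> laurent n (Cplx R)),
    is_basis (F d) B ->
    is_basis (F (d + delta)%N) B' ->
    let sigma (p : laurent n (Cplx R)) := cmeasure_integral mu (leval p) in
    let H := gram (circ_form (@laurent_circ n R) sigma) B' B in
    vanishing_ideal (@leval n R) (supp mu) `&` F d = kernel_in B H).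
Proof. by split; [exact: affine_case|exact: trigonometric_case]. Qed.
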